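(* Let $p$ be an odd prime and let $n,m$ be positive integers. Let $G_1$ be a connected graph of order $n$ and size $n$, and let $G_2$ be a connected graph of order $mp$. Let $g_2:V(G_2)\to\{1,2,\ldots,mp\}$ be a bijection, and put $$\varrho_2=\{ab\in E(G_2):([g_2(a)+g_2(b)]/p)=1\},$$ $$\eta_2=\{ab\in E(G_2):([g_2(a)+g_2(b)]/p)=-1\text{ or }g_2(a)+g_2(b)\equiv 0\pmod p\}.$$ If $$|\varrho_2|=|\eta_2|+m^2p,$$ then the lexicographic product graph $G_1[G_2]$ is a Legendre cordial graph modulo $p$.
   Context: All graphs are finite, simple, and connected. The order and size of a graph are its number of vertices and its number of edges, respectively. Lexicographic product: $G_1[G_2]$ has vertex set $V(G_1)\times V(G_2)$ and edge set $\{(v_1,u_1)(v_2,u_2): v_1v_2\in E(G_1)\text{, or }v_1=v_2\text{ and }u_1u_2\in E(G_2)\}$. Legendre symbol: for an odd prime $p$ and an integer $a$ relatively prime to $p$, $(a/p)=1$ if $x^2\equiv a\pmod p$ has a solution and $(a/p)=-1$ otherwise. Legendre cordial labeling: let $p$ be an odd prime and $H$ a simple connected graph of order $N$. A bijection $f:V(H)\to\{1,2,\ldots,N\}$ is a Legendre cordial labeling modulo $p$ if the induced function $f_p^*:E(H)\to\{0,1\}$, defined by $f_p^*(uv)=0$ if $([f(u)+f(v)]/p)=-1$ or $f(u)+f(v)\equiv 0\pmod p$, and $f_p^*(uv)=1$ if $([f(u)+f(v)]/p)=1$, satisfies $|e_{f_p^*}(0)-e_{f_p^*}(1)|\leq 1$,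 where $e_{f_p^*}(i)$ is the number of edges with label $i$ ($i=0,1$). A graph admitting such a labeling is called a Legendre cordial graph modulo $p$. *)

(* Defs.v *)
From HB Require Import structures.
From mathcomp Require Import all_boot all_order all_algebra.
Set Implicit Arguments.
Unset Strict Implicit.
Unset Printing Implicit Defensive.
Import Order.TTheory GRing.Theory Num.Theory.
Local Open Scope nat_scope.

Record sgraph := SGraph {
  vertex :> finType;
  adj : rel vertex;
  adj_sym : symmetric adj;
  adj_irrefl : irreflexive adj }.

(* Edges are unordered pairs. [edges_with G P] is {ab in E(G) : P a b}; it is
   only meaningful for symmetric P. *)
Definition edges_with (G : sgraph) (P : rel G) : {set {set G}} :=
  [set [set ab.1; ab.2] | ab : G * G & adj ab.1 ab.2 && P ab.1 ab.2].

Definition edges (G : sgraph) : {set {set G}} := edges_with (fun _ _ : G => true).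

Definition connected_graph (G : sgraph) : Prop :=
  0 < #|G| /\ forall u v : G, connect (@adj G) u v.

Section LexProduct.
Variables G1 G2 : sgraph.

Definition lex_adj : rel (G1 * G2) :=
  fun x y => adj x.1 y.1 || (x.1 == y.1) && adj x.2 y.2.

Lemma lex_adj_sym : symmetric lex_adj.
Proof.
by move=> x y; rewrite /lex_adj (adj_sym x.1) (adj_sym x.2) (eq_sym x.1).
Qed.

Lemma lex_adj_irrefl : irreflexive lex_adj.
Proof. by move=> x; rewrite /lex_adj !adj_irrefl andbF. Qed.

Definition lex_product : sgraph := SGraph lex_adj_sym lex_adj_irrefl.
End LexProduct.

(* Solvability of x^2 = a (mod p) is tested on the residues 0 <= x < p, which
   loses nothing by [quad_residueP]. *)
Definition quad_residue (p : nat) (a : int) : bool :=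
  [exists x : 'I_p, ((x : nat)%:Z ^+ 2 == a %[mod p%:Z])%Z]%R.

Lemma quad_residueP (p : nat) (a : int) : 0 < p ->
  reflect (exists x : int, (x ^+ 2 = a %[mod p%:Z])%Z)%R (quad_residue p a).
Proof.
move=> p_gt0; apply: (iffP existsP) => [[x /eqP xa]|[x xa]].
  by exists (x : nat)%:Z%R.
have p_neq0 : p%:Z%R != 0%R by rewrite eqz_nat -lt0n.
have x_ge0 := modz_ge0 x p_neq0.
have x_lt : `|(x %% p%:Z)%Z| < p.
  by rewrite -ltz_nat gez0_abs // ltz_pmod.
exists (Ordinal x_lt); apply/eqP.
by rewrite /= gez0_abs // modzXm.
Qed.

(* The value 0 for a not coprime to p is a convention. *)
Definition legendre (p : nat) (a : int) : int :=
  (if ~~ coprimez a p%:Z then 0 else if quad_residue p a then 1 else -1)%R.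

(* The set {1, ..., N}. *)
Definition label (N : nat) : Type := {k : nat | 0 < k <= N}.

Section Labeling.
Variables (p N : nat) (G : sgraph) (f : G -> label N).

Definition edge_sum (u v : G) : nat := val (f u) + val (f v).

Definition residue_edge (u v : G) : bool :=
  legendre p (edge_sum u v)%:Z%R == 1%R.

Definition nonresidue_edge (u v : G) : bool :=
  (legendre p (edge_sum u v)%:Z%R == (-1)%R) || (edge_sum u v == 0 %[mod p]).

Definition rho : {set {set G}} := edges_with residue_edge.
Definition eta : {set {set G}} := edges_with nonresidue_edge.

(* When p is prime the two cases [nonresidue_edge] and [residue_edge] are
   complementary. *)
Definition edge_label (u v : G) : nat :=
  if nonresidue_edge u v then 0 else 1.

Definition label_count (i : nat) : nat :=
  #|edges_with (fun u v => edge_label u v == i)|.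
End Labeling.

Definition legendre_cordial_labeling (p : nat) (G : sgraph)
    (f : G -> label #|G|) : Prop :=
  bijective f /\
  (`|(label_count p f 0)%:Z - (label_count p f 1)%:Z| <= 1)%R.

Definition legendre_cordial (p : nat) (G : sgraph) : Prop :=
  connected_graph G /\ exists f : G -> label #|G|, legendre_cordial_labeling p f.

(* Main.v *)
Require Import Defs.
From mathcomp Require Import all_boot all_order all_algebra.
From mathcomp Require Import zify.

Set Implicit Arguments.
Unset Strict Implicit.
Unset Printing Implicit Defensive.

Import GRing.Theory Num.Theory.

(** The idea: label the product by blocks. Number the vertices of G1 by
    0, ..., n - 1 and give the vertex (v, a) the label rank(v) * m * p + g2(a).
    This is a bijection onto {1, ..., n * m * p}, and modulo p the label of
    (v, a) is that of a alone, so every edge of the product is classified by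
    its second coordinates.

    The edges of G1[G2] are of two kinds. Each vertex of G1 carries a copy of
    G2, which contributes |rho| edges labeled 1 and |eta| edges labeled 0. Each
    edge of G1 carries one edge for every ordered pair (a, b) of vertices of G2
    ([card_lex_edges_with]). Since g2 takes each residue modulo p exactly m
    times, g2(a) + g2(b) takes each residue m * (m * p) times when (a, b) varies
    ([sum_label_pairs]); as (p - 1) / 2 residues modulo p are nonzero squares
    and (p + 1) / 2 are not ([card_residues]), an edge of G1 contributes m^2 * p
    more edges labeled 0 than edges labeled 1.

    G1 has as many vertices as edges, so the excess |rho| - |eta| = m^2 * p of
    each copy of G2 cancels exactly the deficit of one edge of G1: the two label
    counts are equal. *)

(** * Quadratic residues modulo an odd prime *)

Definition is_residue (p k : nat) : bool := legendre p k%:Z%R == 1%R.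

Lemma is_residueE p k : prime p ->
  is_residue p k = ~~ (p %| k) && [exists x : 'I_p, x ^ 2 == k %[mod p]].
Proof.
move=> p_pr; rewrite /is_residue /legendre coprimezE /= coprime_sym.
rewrite prime_coprime // negbK.
have -> : quad_residue p k = [exists x : 'I_p, x ^ 2 == k %[mod p]].
  by apply: eq_existsb => x; rewrite -rmorphXn /= !modz_nat eqz_nat natrXE.
by case: (p %| k) => //=; case: ifP.
Qed.

(** For prime p the Legendre symbol takes the value 0 exactly on the multiples
    of p, so the two classes of edges are complementary. *)
Lemma nonresidue_edgeE p N (G : sgraph) (f : G -> label N) a b : prime p ->
  nonresidue_edge p f a b = ~~ residue_edge p f a b.
Proof.
move=> p_pr; rewrite /nonresidue_edge /residue_edge /legendre coprimezE /=.
rewrite coprime_sym prime_coprime // negbK mod0n -/(dvdn _ _).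
by case: (p %| _) => //=; case: ifP.
Qed.

Lemma is_residueD p k : prime p -> is_residue p (k + p) = is_residue p k.
Proof.
by move=> p_pr; rewrite !is_residueE // dvdn_addl //; congr andb;
  apply: eq_existsb => x; rewrite modnDr.
Qed.

(** Being prime, p divides (x - y) * (x + y) only if it divides a factor, and in
    the given range this leaves x - y = 0 or x + y = p. *)
Lemma eq_sqr_mod p x y : prime p -> x < p -> 0 < y < p ->
  (x ^ 2 == y ^ 2 %[mod p]) = (x == y) || (x == p - y).
Proof.
move=> p_pr x_lt /andP[y_gt0 y_lt].
wlog le_yx : x y x_lt y_gt0 y_lt / y <= x.
  move=> wl; case: (leqP y x) => [|lt_xy]; first exact: wl.
  case: (posnP x) => [x0|x_gt0].
    rewrite x0 exp0n // mod0n eq_sym -/(dvdn _ _) Euclid_dvdX // gtnNdvd //.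
    by lia.
  by rewrite eq_sym (wl _ _ y_lt x_gt0 x_lt (ltnW lt_xy)); lia.
rewrite eqn_mod_dvd ?leq_sqr // subn_sqr Euclid_dvdM //.
congr orb.
  case: eqP => [->|neq]; first by rewrite subnn dvdn0.
  by rewrite gtnNdvd //; lia.
apply/idP/eqP => [/dvdnP[[|[|k]]]|->]; [lia|lia|nia|by rewrite subnK // ltnW].
Qed.

(** Squaring maps the p - 1 nonzero residues onto the nonzero squares, and it is
    two-to-one there because y and p - y differ when p is odd. *)
Lemma card_residues p : prime p -> odd p ->
  p = (2 * \sum_(k < p) is_residue p k).+1.
Proof.
move=> p_pr p_odd; have p_gt0 := prime_gt0 p_pr.
pose sq (x : 'I_p) : 'I_p := Ordinal (ltn_pmod (x ^ 2) p_gt0).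
pose o := Ordinal p_gt0.
have nz (x : 'I_p) : (x != o) = (0 < x) by rewrite lt0n.
have dvdo (x : 'I_p) : (p %| x) = (x == o).
  by rewrite /dvdn modn_small.
have sqo (x : 'I_p) : (sq x == o) = (x == o).
  by rewrite -!dvdo /= /dvdn modn_mod -/(dvdn p _) Euclid_dvdX // andbT.
have cnt : \sum_(x < p | x != o) 1 = p.-1.
  rewrite sum1_card; have := cardC1 o; rewrite card_ord => <-.
  by apply: eq_card => x; rewrite !inE.
rewrite -[LHS](prednK p_gt0) -cnt; congr _.+1.
(* Sort the nonzero residues x by the value k of their square. *)
rewrite (partition_big sq (fun k => k != o)) => [|x]; last by rewrite sqo.
rewrite big_distrr /= [RHS](bigD1 o) //= {1}is_residueE // dvdn0 add0n.
apply: eq_bigr => k k_nz; rewrite is_residueE // dvdo k_nz /=.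
case: existsP => [[y /eqP yk]|no]; last first.
  rewrite big1 // => x /andP[_ /eqP xk]; case: no; exists x.
  by rewrite -xk /= modn_mod.
have kE : k = y ^ 2 %% p :> nat by rewrite yk modn_small.
have y_gt0 : 0 < y.
  rewrite -nz -sqo; apply: contraNneq k_nz => yo.
  by apply/eqP/val_inj; rewrite /= kE; move/(congr1 val): yo.
have y'_lt : p - y < p by lia.
rewrite muln1 sum1_card (_ : 2 = #|[set y; Ordinal y'_lt]|).
  apply: eq_card => x; rewrite unfold_in !inE -!(inj_eq val_inj) /= kE.
  rewrite eq_sqr_mod // ?y_gt0 ?ltn_ord //.
  by case: x => x x_lt /=; have := ltn_ord y; lia.
by rewrite cards2 -(inj_eq val_inj) /=; have := ltn_ord y; lia.
Qed.

(** * Sums over labels *)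

(** Sliding a window of length p by one step drops F s and gains F (s + p), so
    all windows have the same sum. *)
Lemma sum_period p m s (F : nat -> nat) : (forall k, F (k + p) = F k) ->
  \sum_(k < m * p) F (s + k) = m * \sum_(k < p) F k.
Proof.
move=> F_per.
have window t : \sum_(k < p) F (t + k) = \sum_(k < p) F k.
  elim: t => [|t <-]; first by apply: eq_bigr.
  case: p F_per => [|p] F_per; first by rewrite !big_ord0.
  rewrite big_ord_recr [RHS]big_ord_recl /= addn0 addnC addSn -addnS F_per.
  by congr addn; apply: eq_bigr => k _; rewrite addSn addnS.
elim: m s => [|m IHm] s; first by rewrite big_ord0.
rewrite mulSn big_split_ord /= window mulSn; congr addn.
by rewrite -(IHm (s + p)); apply: eq_bigr => k _; rewrite addnA.
Qed.

Definition ord_label N (i : 'I_N) : label N :=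
  exist (fun k => 0 < k <= N) i.+1 (ltn_ord i).

Lemma ord_label_bij N : bijective (@ord_label N).
Proof.
have pred_lt (l : label N) : (val l).-1 < N by case: l => k /=; lia.
exists (fun l => Ordinal (pred_lt l)) => [i|l]; apply: val_inj => //=.
by case: l => k /=; lia.
Qed.

Lemma sum_labels N (T : finType) (g : T -> label N) (F : nat -> nat) :
  bijective g -> \sum_(t : T) F (val (g t)) = \sum_(k < N) F (1 + k).
Proof.
case=> g' gK g'K.
rewrite (reindex (g' \o @ord_label N)) /=.
  by apply: eq_bigr => i _; rewrite g'K.
apply: onW_bij; apply: bij_comp; last exact: ord_label_bij.
by exists g.
Qed.

(** With the first vertex fixed, the label sums run over m * p consecutive
    integers, that is over m full periods. *)
Lemma sum_label_pairs p m (T : finType) (g : T -> label (m * p))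
    (F : nat -> nat) : bijective g -> (forall k, F (k + p) = F k) ->
  \sum_(a : T) \sum_(b : T) F (val (g a) + val (g b)) =
    m * p * (m * \sum_(k < p) F k).
Proof.
move=> g_bij F_per.
have inner a : \sum_(b : T) F (val (g a) + val (g b)) = m * \sum_(k < p) F k.
  rewrite (sum_labels (fun k => F (val (g a) + k)) g_bij).
  rewrite -(sum_period m (val (g a) + 1) F_per).
  by apply: eq_bigr => k _; rewrite addnA.
rewrite (eq_bigr _ (fun a _ => inner a)) (sum_labels (fun=> _) g_bij).
by rewrite sum_nat_const card_ord.
Qed.

(** * Counting edges *)

Lemma eq_edges_with (G : sgraph) (P Q : rel G) :
  P =2 Q -> edges_with P = edges_with Q.
Proof.
move=> eqPQ; rewrite /edges_with; congr (_ @: mem (pred_of_set _)).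
by apply/setP => ab; rewrite !inE eqPQ.
Qed.

(** Ordered pairs make sums over product graphs factor; every edge comes from
    exactly two of them. *)
Lemma card_edges_with (G : sgraph) (P : rel G) : symmetric P ->
  2 * #|edges_with P| = \sum_(a : G) \sum_(b : G) (adj a b && P a b).
Proof.
move=> P_sym; rewrite pair_bigA /=.
transitivity (\sum_(ab in [set ab : G * G | adj ab.1 ab.2 && P ab.1 ab.2]) 1);
  last first.
  rewrite big_mkcond /=; apply: eq_bigr => ab _; rewrite inE.
  by case: (adj _ _ && _).
rewrite (partition_big_imset (fun ab : G * G => [set ab.1; ab.2])) /=.
rewrite mulnC -sum_nat_const; apply: eq_bigr => e /imsetP[[a b]].
rewrite inE /= => ab ->.
have neq_ab : a != b.
  by apply: contraTneq ab => ->; rewrite adj_irrefl.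
rewrite sum1_card (_ : 2 = #|[set (a, b); (b, a)]|); last first.
  by rewrite cards2 xpair_eqE (negbTE neq_ab).
apply: eq_card => -[c d]; rewrite [RHS]unfold_in !inE /=; apply/orP/andP.
  case=> /eqP[-> ->]; first by rewrite eqxx.
  by rewrite adj_sym P_sym setUC eqxx.
case=> /andP[adj_cd _] /eqP cd_ab.
have c_in : c \in [set a; b] by rewrite -cd_ab !inE eqxx.
have d_in : d \in [set a; b] by rewrite -cd_ab !inE eqxx orbT.
have neq_cd : c != d by apply: contraTneq adj_cd => ->; rewrite adj_irrefl.
move: c_in d_in; rewrite !inE.
case/orP=> /eqP ec; case/orP=> /eqP ed;
  move: neq_cd; rewrite ec ed ?eqxx //; by [left|right].
Qed.

(** An edge of G1 joins the copies of G2 over its two ends completely, while each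
    vertex of G1 carries one copy of G2. An edge vw of G1 sees each ordered pair
    (a, b) once, as the edge from (v, a) to (w, b), whence the undivided double
    sum. *)
Lemma card_lex_edges_with (G1 G2 : sgraph) (P : rel G2) : symmetric P ->
  #|@edges_with (lex_product G1 G2) (fun x y => P x.2 y.2)| =
    #|edges G1| * (\sum_(a : G2) \sum_(b : G2) P a b)
    + #|G1| * #|edges_with P|.
Proof.
move=> P_sym; apply/eqP; rewrite -(eqn_pmul2l (isT : 0 < 2)) mulnDr.
rewrite mulnA (mulnCA 2 #|G1|) !card_edges_with //.
apply/eqP.
(* Both kinds of adjacency are added up over ordered pairs (v, w); they exclude
   each other because G1 has no loops. *)
have sum_pairs (F : G1 * G2 -> nat) : \sum_x F x = \sum_v \sum_a F (v, a).
  by rewrite pair_bigA; apply: eq_bigr => -[].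
set C := \sum_a \sum_b P a b.
set D := \sum_(a : G2) \sum_(b : G2) (adj a b && P a b).
transitivity (\sum_(v : G1) \sum_(w : G1) (adj v w * C + (v == w) * D)).
  apply: etrans (sum_pairs _) _; apply: eq_bigr => v _.
  transitivity (\sum_(a : G2) \sum_(w : G1) \sum_(b : G2)
      (lex_adj (v, a) (w, b) && P a b)).
    by apply: eq_bigr => a _; apply: sum_pairs.
  rewrite exchange_big /=; apply: eq_bigr => w _; rewrite /lex_adj /=.
  have [->|_] := eqVneq v w.
    rewrite adj_irrefl mul0n add0n mul1n; apply: eq_bigr => a _.
    by apply: eq_bigr.
  rewrite mul0n addn0; case: (adj v w); first by rewrite mul1n.
  by rewrite mul0n big1 // => a _; rewrite big1.
rewrite -sum_nat_const big_distrl -big_split /=; apply: eq_bigr => v _.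
rewrite big_split /= big_distrl /=; congr addn.
  by apply: eq_bigr => w _; rewrite andbT.
rewrite (bigD1 v) //= eqxx mul1n big1 ?addn0 // => w.
by rewrite eq_sym => /negbTE->.
Qed.

(** * The labeling of the lexicographic product *)

Lemma connect_homo (T T' : finType) (e : rel T) (e' : rel T') (h : T -> T') :
  (forall x y, e x y -> e' (h x) (h y)) ->
  forall x y, connect e x y -> connect e' (h x) (h y).
Proof.
move=> he x y /connectP[s es ->]; elim: s x es => //= z s IHs x /andP[xz zs].
exact: connect_trans (connect1 (he _ _ xz)) (IHs z zs).
Qed.

(** Walk in a copy of G1 with the second coordinate fixed, then in a copy of
    G2. *)
Lemma lex_product_connected (G1 G2 : sgraph) :
  connected_graph G1 -> connected_graph G2 ->
  connected_graph (lex_product G1 G2).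
Proof.
move=> [G1_gt0 conn1] [G2_gt0 conn2]; split.
  by rewrite card_prod muln_gt0 G1_gt0.
move=> [v a] [w b]; apply: (@connect_trans _ _ (w, a)).
  apply: (connect_homo (h := fun u : G1 => (u, a)) _ (conn1 v w)) => x y xy.
  by rewrite /= /lex_adj xy.
apply: (connect_homo (h := fun u : G2 => (w, u)) _ (conn2 a b)) => x y xy.
by rewrite /= /lex_adj /= eqxx xy orbT.
Qed.

(** The vertices (v, _) receive the block of N consecutive labels that starts
    after rank(v) * N; both coordinates are recovered by Euclidean division. *)
Lemma block_labeling (T1 T2 : finType) N (g : T2 -> label N) :
  #|T2| = N -> bijective g ->
  exists2 f : T1 * T2 -> label #|{: T1 * T2}|, bijective f &
    forall x, val (f x) = enum_rank x.1 * N + val (g x.2).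
Proof.
move=> cardT2 g_bij.
have g_lt t : (val (g t)).-1 < N by case: (g t) => k /=; lia.
have lt_f (x : T1 * T2) :
    enum_rank x.1 * N + (val (g x.2)).-1 < #|{: T1 * T2}|.
  rewrite card_prod cardT2; apply: (@leq_trans ((enum_rank x.1).+1 * N)).
    by rewrite mulSn addnC ltn_add2r.
  by rewrite leq_mul2r ltn_ord orbT.
have lab_gt0 t : 0 < val (g t) by case: (g t) => k /=; lia.
pose h x := Ordinal (lt_f x).
exists (@ord_label _ \o h); last first.
  by move=> x; rewrite -[in RHS](prednK (lab_gt0 x.2)) addnS.
apply: bij_comp; first exact: ord_label_bij.
apply: inj_card_bij; last by rewrite card_ord.
move=> [v a] [w b] /(congr1 val) /= eq_vw.
have N_gt0 : 0 < N by apply: leq_ltn_trans (g_lt a).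
have := congr1 (divn^~ N) eq_vw; rewrite !divnMDl //.
rewrite (divn_small (g_lt a)) (divn_small (g_lt b)) !addn0.
move=> /val_inj/enum_rank_inj vw; subst w; congr pair.
apply: (bij_inj g_bij); apply: val_inj.
by rewrite -(prednK (lab_gt0 a)) -(prednK (lab_gt0 b)) (addnI eq_vw).
Qed.

Theorem theorem3p5 (p n m : nat) (G1 G2 : sgraph) (g2 : G2 -> label (m * p)) :
  prime p -> odd p -> 0 < n -> 0 < m ->
  connected_graph G1 -> #|G1| = n -> #|edges G1| = n ->
  connected_graph G2 -> #|G2| = m * p ->
  bijective g2 ->
  #|rho p g2| = #|eta p g2| + m ^ 2 * p ->
  legendre_cordial p (lex_product G1 G2).
Proof.
move=> p_pr p_odd _ _ conn1 ordG1 sizeG1 conn2 ordG2 g2_bij rho_eta.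
split; first exact: lex_product_connected.
have [h h_bij fE] := block_labeling G1 ordG2 g2_bij.
pose f : lex_product G1 G2 -> label #|lex_product G1 G2| := h.
exists f; split=> //.
pose R : rel G2 := residue_edge p g2.
pose R' : rel G2 := nonresidue_edge p g2.
have R_sym : symmetric R.
  by move=> a b; rewrite /R /residue_edge /edge_sum addnC.
have R'E a b : R' a b = ~~ R a b by exact: nonresidue_edgeE.
have R'_sym : symmetric R' by move=> a b; rewrite !R'E R_sym.
(* The block offsets are multiples of p. *)
have res_f x y : residue_edge p f x y = R x.2 y.2.
  rewrite /R /residue_edge /edge_sum /f !fE.
  rewrite addnACA !mulnA -!mulnDl addnC.
  elim: (X in _ + X * p) => [|k IHk]; first by rewrite addn0.
  by rewrite mulSnr addnA -[LHS]/(is_residue _ _) is_residueD.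
have lab0 : label_count p f 0 =
    #|@edges_with (lex_product G1 G2) (fun x y => R' x.2 y.2)|.
  congr #|pred_of_set _|; apply: eq_edges_with => x y.
  by rewrite /edge_label nonresidue_edgeE // R'E -res_f; case: residue_edge.
have lab1 : label_count p f 1 =
    #|@edges_with (lex_product G1 G2) (fun x y => R x.2 y.2)|.
  congr #|pred_of_set _|; apply: eq_edges_with => x y.
  by rewrite /edge_label nonresidue_edgeE // -res_f; case: residue_edge.
pose q := \sum_(k < p) is_residue p k.
have sumR : \sum_(a : G2) \sum_(b : G2) R a b = m * p * (m * q).
  apply: (sum_label_pairs (F := is_residue p) g2_bij) => k.
  by rewrite is_residueD.
have sumR' : \sum_(a : G2) \sum_(b : G2) R' a b = m * p * (m * q.+1).
  have q' : \sum_(k < p) ~~ is_residue p k = q.+1.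
    apply: (@addnI q); rewrite addnS addnn -mul2n -card_residues //.
    rewrite -big_split /= -[RHS]card_ord -sum1_card.
    by apply: eq_bigr => k _; case: is_residue.
  rewrite -q' -(sum_label_pairs (F := fun k => ~~ is_residue p k) g2_bij).
    by apply: eq_bigr => a _; apply: eq_bigr => b _; rewrite R'E.
  by move=> k; rewrite is_residueD.
have -> : label_count p f 0 = label_count p f 1; last by rewrite subrr normr0.
rewrite lab0 lab1 !card_lex_edges_with // sumR sumR' ordG1 sizeG1 -!mulnDr.
rewrite -[X in _ = _ * (_ + X)]/#|rho p g2| rho_eta -/(eta p g2).
by rewrite mulnS; lia.
Qed.
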